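(* Let $G$ be a unicyclic graph. Then $G$ has exactly three distinct normalized Laplacian eigenvalues if and only if $G=C_4$ or $G=C_5$.
   Context: A unicyclic graph is a connected graph with $n$ vertices and $n$ edges. $C_n$ denotes the cycle on $n$ vertices. For a graph with adjacency matrix $A$ and diagonal degree matrix $D$ (no isolated vertices), the normalized Laplacian is $\mathcal{L}=I-D^{-1/2}AD^{-1/2}$, and its eigenvalues are the normalized Laplacian eigenvalues. *)

(* Defs.v *)
From HB Require Import structures.
From mathcomp Require Import all_boot all_order all_algebra.
From mathcomp Require Import reals.
Set Implicit Arguments. Unset Strict Implicit. Unset Printing Implicit Defensive.
Import Order.TTheory GRing.Theory Num.Theory.
Local Open Scope ring_scope.

Definition simple_graph (n : nat) (e : rel 'I_n) : Prop :=
  symmetric e /\ irreflexive e.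

Definition num_edges (n : nat) (e : rel 'I_n) : nat :=
  #|[set [set x; y] | x in 'I_n, y in 'I_n & e x y]|.

Definition connected_graph (n : nat) (e : rel 'I_n) : Prop :=
  (0 < n)%N /\ forall x y : 'I_n, connect e x y.

Definition unicyclic (n : nat) (e : rel 'I_n) : Prop :=
  [/\ simple_graph e, connected_graph e & num_edges e = n].

Definition deg (n : nat) (e : rel 'I_n) (x : 'I_n) : nat := #|[set y | e x y]|.

Definition adj_mx (R : realType) (n : nat) (e : rel 'I_n) : 'M[R]_n :=
  \matrix_(i, j) (e i j)%:R.

Definition deg_inv_sqrt_mx (R : realType) (n : nat) (e : rel 'I_n) : 'M[R]_n :=
  diag_mx (\row_i (Num.sqrt ((deg e i)%:R : R))^-1).

Definition norm_laplacian (R : realType) (n : nat) (e : rel 'I_n) : 'M[R]_n :=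
  1%:M - deg_inv_sqrt_mx R e *m adj_mx R e *m deg_inv_sqrt_mx R e.

Definition num_distinct_eigenvalues_eq (R : realType) (n : nat) (M : 'M[R]_n)
  (k : nat) : Prop :=
  exists s : seq R, [/\ uniq s, size s = k & forall a, eigenvalue M a = (a \in s)].

Definition cycle_rel (k : nat) : rel 'I_k :=
  fun i j => (j == (i.+1 %% k)%N :> nat) || (i == (j.+1 %% k)%N :> nat).

Definition graph_iso (n m : nat) (e : rel 'I_n) (e' : rel 'I_m) : Prop :=
  exists f : 'I_n -> 'I_m, bijective f /\ forall x y, e' (f x) (f y) = e x y.
Arguments cycle_rel k : clear implicits.

(* Main.v *)
Require Import Defs.
From HB Require Import structures.
From mathcomp Require Import all_boot all_order all_algebra.
From mathcomp Require Import reals.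
From mathcomp Require Import complex spectral sesquilinear ring lra zify.

(** If the normalized Laplacian L has exactly the eigenvalues 0, a and b, then
    (L - a)(L - b) is a nonzero multiple of u^T u, where u_x = sqrt(deg x) spans
    the kernel of L.  Off the diagonal this says, for some alpha <> 0 and s,
      sum over common neighbours z of x, y of 1/deg z  -  s [x ~ y]
        = alpha * deg x * deg y,
    so nonadjacent vertices have a common neighbour.  A neighbour v of a leaf is
    then adjacent to all vertices and all vertices other than v and the leaf
    have the same degree, so that the degree sum 2n leaves only the triangle
    with one pendant edge, which violates the identity.  Hence all degrees
    equal 2, and diameter at most 2 leaves C_3, C_4 and C_5; C_3 is complete
    and has only one nonzero eigenvalue. *)

Set Implicit Arguments.
Unset Strict Implicit.
Unset Printing Implicit Defensive.
Import Order.TTheory GRing.Theory Num.Theory.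
Local Open Scope ring_scope.

(** * Annihilating polynomials of real symmetric matrices *)

(** Over the complex extension of [R] the matrix is Hermitian, hence unitarily diagonalizable with
    real diagonal. Each diagonal entry is an eigenvalue of [A], so the product of the linear factors
    kills the whole diagonal; injectivity of the embedding brings the identity back to [R]. *)
Lemma symmetric_annihilated (R : rcfType) n (A : 'M[R]_n.+1) (s : seq R) :
  A^T = A -> (forall a, eigenvalue A a -> a \in s) ->
  horner_mx A (\prod_(a <- s) ('X - a%:P)) = 0.
Proof.
move=> Asym As; set f := real_complex R; set B := map_mx f A.
have Bherm : B \is hermsymmx.
  apply/is_hermitianmxP; rewrite expr0 scale1r.
  apply/matrixP=> i j; rewrite !mxE -{1}Asym mxE.
  by apply/esym/conj_Creal; rewrite complex_real.
have /orthomx_spectralP BE := hermitian_normalmx Bherm.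
set P := spectralmx B in BE; set d := spectral_diag B in BE.
have Pu : P \in unitmx by exact: spectral_unit.
(* Row [i] of the invertible matrix [P] is a nonzero left eigenvector of [B] for [d 0 i]; since
   [d 0 i] is real, it is already an eigenvalue of [A]. *)
have dP i : exists2 a, d 0 i = f a & a \in s.
  have eigd : eigenvalue B (d 0 i).
    apply/eigenvalueP; exists (row i P).
      by rewrite -row_mul {1}BE -mulmxA mulKVmx // row_mul row_diag_mx -scalemxAl -rowE.
    apply: contraTneq Pu => Pi0; apply/negP=> Pu.
    have := congr1 (row i) (mulmxV Pu); rewrite row_mul Pi0 mul0mx.
    by move/rowP/(_ i)/eqP; rewrite !mxE eqxx eq_sym oner_eq0.
  have /mxOverP/(_ 0 i)/complex_realP [a da] := hermitian_spectral_diag_real Bherm.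
  by exists a => //; apply: As; move: eigd; rewrite da -(eigenvalue_map f).
apply: (map_mx_inj (f := f)); rewrite map_horner_mx -/B map_mx0.
have -> : B = invmx P *m diag_mx d *m invmx (invmx P) by rewrite invmxK.
rewrite horner_mx_uconj ?unitmx_inv // horner_mx_diag.
suff -> : map_mx (horner (map_poly f (\prod_(a <- s) ('X - a%:P)))) d = 0.
  by rewrite linear0 mulmx0 mul0mx.
apply/rowP=> i; rewrite !mxE; have [a -> sa] := dP i.
rewrite horner_map; apply/eqP; rewrite fmorph_eq0.
by rewrite -/(root _ a) root_prod_XsubC.
Qed.

(** * Degrees and connectivity *)

(** Handshake lemma: the map from ordered adjacent pairs to unordered edges has fibres of size
    exactly two, because there are no loops. *)
Lemma sum_deg (n : nat) (e : rel 'I_n) :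
  simple_graph e -> (\sum_x deg e x)%N = (num_edges e).*2.
Proof.
case=> esym eirr.
have -> : (\sum_x deg e x)%N = #|[set p : 'I_n * 'I_n | e p.1 p.2]|.
  rewrite -sum1_card (eq_bigr (fun x => \sum_(y | e x y) 1)%N) => [|x _].
    by rewrite pair_big_dep; apply: eq_bigl => p; rewrite inE.
  by rewrite sum1dep_card.
have -> : num_edges e =
    #|[set [set p.1; p.2] | p in [set p : 'I_n * 'I_n | e p.1 p.2]]|.
  apply: eq_card => A; apply/imset2P/imsetP => [[x y _]|[[x y]]].
    by rewrite !inE => exy ->; exists (x, y); rewrite ?inE.
  by rewrite !inE => exy ->; exists x y; rewrite ?inE.
rewrite -sum1_card (partition_big_imset (fun p => [set p.1; p.2])) /=.
rewrite -muln2 -sum_nat_const; apply: eq_bigr => A /imsetP[[x y]].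
rewrite inE /= => exy ->; rewrite sum1dep_card.
have xy : x != y by apply: contraTneq exy => ->; rewrite eirr.
rewrite (_ : [set _ | _] = [set (x, y); (y, x)]).
  by rewrite cards2 xpair_eqE negb_and xy.
apply/setP=> [[z t]]; rewrite !inE /= !xpair_eqE.
apply/idP/idP => [/andP[ezt /eqP/setP E]|].
  have zt : z != t by apply: contraTneq ezt => ->; rewrite eirr.
  have /set2P zxy : z \in [set x; y] by rewrite -E set21.
  have /set2P txy : t \in [set x; y] by rewrite -E set22.
  by case: zxy txy zt => -> [] ->; rewrite ?eqxx ?orbT.
by case/orP=> /andP[/eqP-> /eqP->]; rewrite ?eqxx ?exy ?(esym y x) ?exy // setUC eqxx.
Qed.

Lemma deg_gt0 (n : nat) (e : rel 'I_n) x :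
  connected_graph e -> (1 < n)%N -> (0 < deg e x)%N.
Proof.
move=> [_ econ] n_gt1.
have [y xy] : exists y : 'I_n, y != x.
  have: (0 < #|[set~ x]|)%N by rewrite cardsC1 card_ord; lia.
  by case/card_gt0P=> y; rewrite !inE; exists y.
have /connectP[[|z p] /= ezp yE] := econ x y; first by rewrite yE eqxx in xy.
by apply/card_gt0P; exists z; rewrite inE; case/andP: ezp.
Qed.

Lemma natr_deg (R : realType) (n : nat) (e : rel 'I_n) x :
  (deg e x)%:R = \sum_y (e x y)%:R :> R.
Proof.
by rewrite /deg -sum1dep_card natr_sum big_mkcond; apply: eq_bigr => y _; case: e.
Qed.

Lemma connected_constant (n : nat) (e : rel 'I_n) (T : Type) (w : 'I_n -> T) :
  connected_graph e -> (forall x y, e x y -> w x = w y) -> forall x y, w x = w y.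
Proof.
move=> [_ econ] we x y; have /connectP[p] := econ x y.
elim: p x => [|z p IHp] x /=; first by move=> _ ->.
by case/andP=> /we -> /IHp; apply.
Qed.

(** * The normalized Laplacian and its kernel *)

Section NormalizedLaplacian.

Variables (R : realType) (n : nat) (e : rel 'I_n).
Hypotheses (e_sym : symmetric e) (e_irr : irreflexive e).
Hypothesis degP : forall x, (0 < deg e x)%N.

Local Notation d x := ((deg e x)%:R : R).
Local Notation q x := (Num.sqrt (d x)).
Local Notation L := (norm_laplacian R e).

Let q_neq0 x : q x != 0.
Proof. by rewrite gt_eqF // sqrtr_gt0 ltr0n. Qed.

Let qq x : q x * q x = d x.
Proof. by rewrite -expr2 sqr_sqrtr ?ler0n. Qed.

Lemma norm_adjE i j :
  (deg_inv_sqrt_mx R e *m adj_mx R e *m deg_inv_sqrt_mx R e) i j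
    = (e i j)%:R / (q i * q j).
Proof.
rewrite /deg_inv_sqrt_mx mul_mx_diag mxE mul_diag_mx !mxE invfM.
by rewrite mulrAC mulrC mulrA mulrAC -mulrA mulrC.
Qed.

Lemma norm_laplacianE i j : L i j = (i == j)%:R - (e i j)%:R / (q i * q j).
Proof. by rewrite /norm_laplacian 3!mxE norm_adjE. Qed.

Lemma norm_laplacian_sym : L^T = L.
Proof.
by apply/matrixP=> i j; rewrite mxE !norm_laplacianE e_sym (mulrC (q i)) (eq_sym j).
Qed.

(** In the coordinates [w x = v 0 x / q x] the right-hand side is [d y * w y] minus the sum of [w]
    over the neighbours of [y], so eigenvector equations become free of square roots. *)
Lemma mul_norm_laplacian (v : 'rV_n) y :
  (v *m L) 0 y * q y = v 0 y * q y - \sum_x (e x y)%:R * (v 0 x / q x).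
Proof.
rewrite mxE mulr_suml (eq_bigr (fun x =>
  v 0 x * q x * (x == y)%:R - (e x y)%:R * (v 0 x / q x))) => [|x _].
  rewrite sumrB (bigD1 y) //= eqxx mulr1 big1 ?addr0 // => x /negPf->.
  by rewrite mulr0.
rewrite norm_laplacianE; case: eqVneq => [->|xy] /=; last first.
  by field; rewrite !q_neq0.
by rewrite e_irr; field; rewrite q_neq0.
Qed.

Lemma norm_laplacian_sqrt_deg : (\row_x q x) *m L = 0.
Proof.
apply/rowP=> y; apply: (mulIf (q_neq0 y)); rewrite mul_norm_laplacian !mxE mul0r.
rewrite qq natr_deg; apply/eqP; rewrite subr_eq0; apply/eqP/eq_bigr => x _.
by rewrite mxE divff // mulr1 e_sym.
Qed.

(* The Dirichlet form of a null vector vanishes, which forces it to be constant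
   along edges after rescaling by [D^{-1/2}]. *)
Lemma norm_laplacian_ker (v : 'rV_n) : connected_graph e ->
  v *m L = 0 -> exists c, forall x, v 0 x = c * q x.
Proof.
move=> econ vL; pose w x := v 0 x / q x.
have wE y : d y * w y = \sum_x (e x y)%:R * w x.
  apply/eqP; rewrite -subr_eq0 -qq.
  have := mul_norm_laplacian v y; rewrite vL mxE mul0r => /esym/eqP.
  by congr (_ - _ == 0); rewrite /w; field; rewrite q_neq0.
have D0 : \sum_y \sum_x (e x y)%:R * (w x - w y) ^+ 2 = 0.
  (* After expanding the squares, [wE] turns the cross term into [- 2 * d y * w y ^+ 2]; exchanging
     the sums gives the other two terms the same total [d y * w y ^+ 2] each, and everything
     cancels. *)
  rewrite (eq_bigr (fun y => \sum_x (e y x)%:R * (w x) ^+ 2 +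
    (d y * (w y) ^+ 2 - 2 * (w y * \sum_x (e x y)%:R * w x)))) => [|y _].
    rewrite big_split exchange_big /= -big_split /= big1 // => y _.
    rewrite -wE -mulr_suml.
    by under eq_bigr do rewrite e_sym; rewrite -natr_deg; ring.
  rewrite natr_deg !mulr_suml !mulr_sumr -sumrB -big_split /=.
  by apply: eq_bigr => x _; rewrite (e_sym y); ring.
have pos a b : 0 <= (e a b)%:R * (w a - w b) ^+ 2.
  by rewrite mulr_ge0 ?ler0n ?sqr_ge0.
have we x y : e x y -> w x = w y.
  move=> exy; apply/eqP; rewrite -subr_eq0 -sqrf_eq0.
  have := psumr_eq0P (fun b _ => sumr_ge0 _ (fun a _ => pos a b)) D0.
  move=> /(_ y isT) /(psumr_eq0P (fun a _ => pos a y)) => /(_ x isT).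
  by rewrite exy mul1r => ->.
have [n_gt0 _] := econ.
exists (w (Ordinal n_gt0)) => x.
by rewrite (connected_constant econ we _ x) /w divfK.
Qed.

End NormalizedLaplacian.

(** * From three eigenvalues to the common-neighbour identity *)

Lemma three_eigenvalues_nonzero (R : realType) n (M : 'M[R]_n) :
  num_distinct_eigenvalues_eq M 3 -> eigenvalue M 0 ->
  exists a b, [/\ a != 0, b != 0, a != b, eigenvalue M a & eigenvalue M b]
    /\ forall c, eigenvalue M c -> c \in [:: 0; a; b].
Proof.
move=> [s [s_uniq s_size sP]]; rewrite sP => s0.
have s_perm := perm_to_rem s0.
case E : (rem 0 s) s_perm => [|a [|b [|? ?]]] s_perm;
  have := perm_size s_perm; rewrite s_size //= => _.
have := perm_uniq s_perm; rewrite s_uniq /= !inE !negb_or => /esym.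
case/and3P=> /andP[a0 b0] ab _; exists a, b; split.
  by split; rewrite ?sP ?(perm_mem s_perm) ?inE ?eqxx ?orbT // eq_sym.
by move=> c; rewrite sP (perm_mem s_perm).
Qed.

Lemma three_eigenvalues_common_neighbours (R : realType) n (e : rel 'I_n) :
  simple_graph e -> connected_graph e -> (1 < n)%N ->
  num_distinct_eigenvalues_eq (norm_laplacian R e) 3 ->
  exists alpha s : R, alpha != 0 /\ forall x y, x != y ->
    \sum_z (e x z && e z y)%:R / (deg e z)%:R - s * (e x y)%:R
      = alpha * (deg e x)%:R * (deg e y)%:R.
Proof.
case: n e => // n e [e_sym e_irr] econ n_gt1 e3.
have degP x : (0 < deg e x)%N by exact: deg_gt0.
pose q x : R := Num.sqrt (deg e x)%:R; pose u : 'rV[R]_n.+1 := \row_x q x.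
have q0 x : q x != 0 by rewrite gt_eqF // sqrtr_gt0 ltr0n.
have qq x : q x * q x = (deg e x)%:R by rewrite -expr2 sqr_sqrtr ?ler0n.
have u0 : u != 0.
  by apply/eqP=> /rowP/(_ 0)/eqP; rewrite !mxE (negPf (q0 _)).
set L := norm_laplacian R e in e3 *.
have uL : u *m L = 0 by exact: norm_laplacian_sqrt_deg.
have Lsym : L^T = L by exact: norm_laplacian_sym.
have Lker (v : 'rV_n.+1) : v *m L = 0 -> exists c, forall x, v 0 x = c * q x.
  exact: norm_laplacian_ker.
set N := deg_inv_sqrt_mx R e *m adj_mx R e *m deg_inv_sqrt_mx R e.
have LE t : L - t%:M = (1 - t)%:M - N.
  by rewrite /L /norm_laplacian -/N raddfB addrAC.
have NE i j : N i j = (e i j)%:R / (q i * q j) by exact: norm_adjE.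
clearbody L N.
have L0 : eigenvalue L 0 by apply/eigenvalueP; exists u; rewrite ?scale0r.
have [a [b [[a0 b0 ab _ _] abP]]] := three_eigenvalues_nonzero e3 L0.
pose X := (L - a%:M) *m (L - b%:M).
have LC c : (L - c%:M) *m L = L *m (L - c%:M).
  by rewrite mulmxBl mulmxBr scalar_mxC.
have XT : X^T = X.
  have LT t : (L - t%:M)^T = L - t%:M by rewrite linearB /= Lsym tr_scalar_mx.
  by rewrite /X trmx_mul !LT mulmxBr LC scalar_mxC -mulmxBl.
(* The polynomial with roots 0, [a], [b] annihilates the symmetric matrix [L]; its factors commute,
   so [L] can be moved to the right. *)
have XL : X *m L = 0.
  have := symmetric_annihilated Lsym abP.
  rewrite !big_cons big_nil mulr1 !rmorphM !rmorphB /= !horner_mx_X !horner_mx_C.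
  by rewrite raddf0 subr0 => LX; rewrite /X -mulmxA LC mulmxA LC -mulmxA.
have XE i : exists c, forall j, X i j = c * q j.
  have [] := Lker (row i X).
    by rewrite -row_mul XL row0.
  by move=> c cP; exists c => j; rewrite -cP [RHS]mxE.
have [c cP] := XE 0.
(* Each row of [X] lies in the kernel of [L], hence is a multiple of [u]; symmetry of [X] ties the
   coefficient of row [i] to that of row 0, leaving one constant. *)
have {}XE i j : X i j = c / q 0 * q i * q j.
  have [c' c'P] := XE i; rewrite c'P; congr (_ * _).
  have : c' * q 0 = c * q i by rewrite -c'P -cP -[in LHS]XT [LHS]mxE.
  by move=> E; rewrite mulrAC -E mulfK.
exists (c / q 0), (2 - a - b); split=> [|x y xy].
  (* If the constant vanished, so would [X]; but [u *m X = (a * b) *: u]. *)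
  apply: contraNneq u0 => c0.
  have : u *m X = 0.
    by rewrite (_ : X = 0) ?mulmx0 //; apply/matrixP=> i j; rewrite XE c0 !mul0r mxE.
  have uLt t : u *m (L - t%:M) = - t *: u.
    by rewrite mulmxBr uL mul_mx_scalar sub0r scaleNr.
  rewrite mulmxA uLt -scalemxAl uLt scalerA mulrNN => /eqP.
  by rewrite scaler_eq0 mulf_eq0 (negPf a0) (negPf b0).
have : X x y * (q x * q y) = c / q 0 * (deg e x)%:R * (deg e y)%:R.
  by rewrite XE -!qq; ring.
move=> <-.
(* Here [2 - a - b] is [(1 - a) + (1 - b)]. The scalar matrix only affects the diagonal, and the
   entries of [N *m N] count common neighbours weighted by inverse degree. *)
have -> : X = N *m N - (2 - a - b) *: N + ((1 - a) * (1 - b))%:M.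
  rewrite /X !LE mulmxBl !mulmxBr -scalar_mxM mul_scalar_mx mul_mx_scalar.
  by apply/matrixP=> i j; move: (N *m N) => NN; rewrite !mxE; ring.
rewrite !mxE (negPf xy) addr0 NE [RHS]mulrBl mulr_suml.
congr (_ - _); last by field; rewrite !q0.
apply: eq_bigr => z _; rewrite !NE.
by rewrite -qq; case: (e x z); case: (e z y) => /=; field; rewrite !q0.
Qed.

(** * Graph structure forced by the identity *)

Lemma deg_lt (n : nat) (e : rel 'I_n) x : irreflexive e -> (deg e x < n)%N.
Proof.
move=> e_irr; have: (deg e x <= #|[set~ x]|)%N.
  apply/subset_leq_card/subsetP=> y; rewrite !inE.
  by apply: contraTneq => ->; rewrite e_irr.
by rewrite cardsC1 card_ord; have := ltn_ord x; lia.
Qed.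

Lemma two_neighbours (n : nat) (e : rel 'I_n) x y :
  deg e x = 2%N -> e x y ->
  exists2 z, y != z & forall t, e x t = (t == y) || (t == z).
Proof.
move=> /eqP/cards2P[a [b [ab /setP E]]] exy.
have Ex t : e x t = (t == a) || (t == b) by have := E t; rewrite !inE.
move: exy; rewrite Ex => /orP[]/eqP->; first by exists b.
by exists a => [|t]; [rewrite eq_sym | rewrite Ex orbC].
Qed.

(** Listing the vertices once each, in cyclic order, gives a bijection from ['I_k], whose inverse is
    the isomorphism. Recognizing a cycle is thus reduced to a finite adjacency table. *)
Lemma graph_iso_cycle (n k : nat) (e : rel 'I_n) x0 (s : seq 'I_n) :
  uniq s -> size s = k -> (forall y, y \in s) ->
  (forall i j, i < k -> j < k -> e (nth x0 s i) (nth x0 s j) =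
     (j == i.+1 %% k) || (i == j.+1 %% k))%N ->
  graph_iso e (cycle_rel k).
Proof.
move=> s_uniq sk s_all sP; pose g (i : 'I_k) := nth x0 s i.
have g_inj : injective g.
  by move=> i j /eqP; rewrite nth_uniq ?sk // => /eqP/val_inj.
have [|f gK fK] := inj_card_bij g_inj.
  rewrite !card_ord -sk -[X in (X <= _)%N]card_ord -(card_uniqP s_uniq).
  by apply/subset_leq_card/subsetP=> y _; apply: s_all.
exists f; split=> [|x y]; first by exists g.
by rewrite -[in RHS](fK x) -[in RHS](fK y) [RHS]sP.
Qed.

(** Let [a], [b] be the neighbours of [x], and [c], [c'] the further neighbours of [a] and [b].
    Every vertex is within distance two of [x], so these five exhaust the graph. If [c = b] it is a
    triangle, if [c = c'] a 4-cycle, and otherwise a 5-cycle. *)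
Lemma two_regular_diameter2 (n : nat) (e : rel 'I_n) :
  simple_graph e -> (0 < n)%N -> (forall x, deg e x = 2%N) ->
  (forall x y, x != y -> ~~ e x y -> exists2 z, e x z & e z y) ->
  [\/ n = 3%N, graph_iso e (cycle_rel 4) | graph_iso e (cycle_rel 5)].
Proof.
move=> [e_sym e_irr] n_gt0 deg2 common; pose x := Ordinal n_gt0.
have neq y z : e y z -> y != z by apply: contraTneq => ->; rewrite e_irr.
have [a exa] : exists a, e x a.
  have: (0 < deg e x)%N by rewrite deg2.
  by case/card_gt0P=> a; rewrite inE; exists a.
have [b ab Ex] := two_neighbours (deg2 x) exa.
have exb : e x b by rewrite Ex eqxx orbT.
have [c xc Ea] : exists2 c, x != c & forall t, e a t = (t == x) || (t == c).
  by apply: two_neighbours; rewrite // e_sym.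
have [c' xc' Eb] : exists2 c, x != c & forall t, e b t = (t == x) || (t == c).
  by apply: two_neighbours; rewrite // e_sym.
have eac : e a c by rewrite Ea eqxx orbT.
have ebc' : e b c' by rewrite Eb eqxx orbT.
have xa := neq _ _ exa; have xb := neq _ _ exb.
have ac := neq _ _ eac; have bc' := neq _ _ ebc'.
have all5 y : y \in [:: x; a; c; c'; b].
  rewrite !inE; case: (eqVneq y x) => //= yx.
  have [|/common] := boolP (e x y); first by rewrite Ex => /orP[] ->; rewrite ?orbT.
  rewrite eq_sym => /(_ yx)[z]; rewrite Ex => /orP[]/eqP->.
    by rewrite Ea (negPf yx) => /= ->; rewrite orbT.
  by rewrite Eb (negPf yx) => /= ->; rewrite !orbT.
case: (eqVneq c b) => [cb|cb].
  have c'a : a = c'.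
    by move: eac; rewrite cb e_sym Eb eq_sym (negPf xa) => /eqP.
  apply: Or31; have /card_uniqP u3 : uniq [:: x; a; b] by rewrite /= !inE negb_or xa xb ab.
  rewrite -[LHS]card_ord -[RHS]u3.
  by apply: eq_card => y; have := all5 y; rewrite cb -c'a !inE;
    case: (y == x); case: (y == a); case: (y == b).
(* If [c' = a], then [b] is adjacent to [a] and differs from [x], which forces [c = b]. *)
have c'a : c' != a.
  apply: contraNneq cb => c'a; move: ebc'; rewrite c'a e_sym Ea.
  by rewrite eq_sym (negPf xb) eq_sym.
case: (eqVneq c c') => [cc'|cc'].
  apply: Or32; apply: (@graph_iso_cycle _ 4 _ x [:: x; a; c; b]) => //.
  - by rewrite /= !inE !negb_or xa xc xb ac ab cb.
  - by move=> y; have := all5 y; rewrite -cc' !inE; case: (y == c); rewrite ?orbT.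
  have [b' ab' Ec] : exists2 t, a != t & forall y, e c y = (y == a) || (y == t).
    by apply: two_neighbours; rewrite // e_sym.
  have b'b : b = b'.
    have : e c b by rewrite e_sym cc'.
    by rewrite Ec eq_sym (negPf ab) => /eqP.
  move=> [|[|[|[|//]]]] [|[|[|[|//]]]] _ _ /=; rewrite ?(Ex, Ea, Ec, Eb) -?b'b
    -?cc' ?eqxx ?orbT //; apply/negbTE/norP;
    by split; first [assumption | rewrite eq_sym; assumption].
apply: Or33; apply: (@graph_iso_cycle _ 5 _ x [:: x; a; c; c'; b]) => //.
  by rewrite /= !inE !negb_or xa xc xb ac ab cb xc' cc' eq_sym c'a eq_sym bc'.
have [t at' Ec] : exists2 t, a != t & forall y, e c y = (y == a) || (y == t).
  by apply: two_neighbours; rewrite // e_sym.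
have [t' bt' Ec'] : exists2 t, b != t & forall y, e c' y = (y == b) || (y == t).
  by apply: two_neighbours; rewrite // e_sym.
have ect : e c t by rewrite Ec eqxx orbT.
(* The second neighbour [t] of [c] can only be [c']: the neighbours of [x] and of [b] are already
   known and [c] is not among them. *)
have tc' : c' = t.
  move: (all5 t) (neq _ _ ect) (ect); rewrite !inE => /or4P[||/eqP->|].
  - by move=> /eqP-> _; rewrite e_sym Ex (negPf cb) eq_sym (negPf ac).
  - by rewrite eq_sym (negPf at').
  - by rewrite eqxx.
  case/orP=> /eqP-> // _.
  by rewrite e_sym Eb (negPf cc') orbF eq_sym (negPf xc).
have t'c : c = t'.
  by move: ect; rewrite -tc' e_sym Ec' (negPf cb) => /eqP.
move=> [|[|[|[|[|//]]]]] [|[|[|[|[|//]]]]] _ _ /=;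
  rewrite ?(Ex, Ea, Ec, Eb, Ec') -?tc' -?t'c ?eqxx ?orbT //; apply/negbTE/norP;
  by split; first [assumption | rewrite eq_sym; assumption].
Qed.

Lemma no_leaf (R : realType) (n : nat) (e : rel 'I_n) (alpha s : R) :
  simple_graph e -> (\sum_x deg e x)%N = n.*2 -> (2 < n)%N ->
  (forall x, 0 < deg e x)%N ->
  alpha != 0 -> (forall x y, x != y ->
    \sum_z (e x z && e z y)%:R / (deg e z)%:R - s * (e x y)%:R
      = alpha * (deg e x)%:R * (deg e y)%:R) ->
  (forall x y, x != y -> ~~ e x y -> exists2 z, e x z & e z y) ->
  forall x, deg e x != 1%N.
Proof.
move=> [e_sym e_irr] esum n_gt2 degP alpha0 E common x.
apply/negP=> degx; have [v /setP Nx] := cards1P degx; move/eqP: degx => degx.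
have {}Nx y : e x y = (y == v) by have := Nx y; rewrite !inE.
have exv : e x v by rewrite Nx.
have xv : x != v by apply: contraTneq exv => ->; rewrite e_irr.
(* A vertex not adjacent to the leaf [x] shares a neighbour with it, and this can only be [v]. *)
have Nv y : e v y = (y != v).
  have [->|yv] := eqVneq y v; first exact: e_irr.
  have [->|yx] := eqVneq y x; first by rewrite e_sym.
  have [||z] := common x y; rewrite 1?eq_sym ?Nx //.
  by move=> /eqP->.
have degv : deg e v = n.-1.
  rewrite -[n in RHS]card_ord -(cardsC1 v); apply: eq_card => y.
  by rewrite !inE Nv.
(* The only common neighbour of [x] and [y] is [v], of degree [n - 1]. Hence the degree of [y] does
   not depend on [y]. *)
have Exy y : y != x -> y != v -> (n.-1%:R)^-1 = alpha * (deg e y)%:R.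
  move=> yx yv; have := E x y; rewrite eq_sym yx degx mulr1 => /(_ isT) <-.
  rewrite Nx (negPf yv) mulr0 subr0 (bigD1 v) //= Nx eqxx Nv yv degv.
  rewrite mul1r big1 ?addr0 // => z /negPf zv.
  by rewrite Nx zv mul0r.
have cardV : #|[set~ x] :\ v| = (n - 2)%N.
  have := cardsD1 v [set~ x].
  by rewrite cardsC1 card_ord !inE eq_sym xv; lia.
have [y] : exists y, y \in [set~ x] :\ v.
  by apply/card_gt0P; rewrite cardV; lia.
rewrite !inE => /andP[yv yx].
have degy z : z != x -> z != v -> deg e z = deg e y.
  move=> zx zv; have := Exy z zx zv; rewrite (Exy y) // => /(mulfI alpha0)/eqP.
  by rewrite eqr_nat => /eqP.
(* The degree sum is [1 + (n - 1) + (n - 2) * deg e y = 2n]. *)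
have : (2 + (n - 2) * deg e y = n.+2)%N.
  move: esum; rewrite (bigD1 x) //= (bigD1 v) 1?eq_sym //= degx degv.
  rewrite (eq_bigl (fun z => z \in [set~ x] :\ v)) => [|z]; last first.
    by rewrite !inE andbC.
  rewrite (eq_bigr (fun=> deg e y)) => [|z].
    by rewrite sum_nat_const cardV; lia.
  by rewrite !inE => /andP[? ?]; apply: degy.
have degy_lt := deg_lt y e_irr => degyE.
(* From [(n - 2) * deg e y = n], the difference [n - 2] divides 2. This leaves [n = 4] with degree
   2, or [n = 3] with degree 3, which [deg e y < n] excludes. *)
have [n3 degy2] : n.-1 = 3%N /\ deg e y = 2%N.
  by case: (deg e y) degyE degy_lt => [|[|[|k]]]; nia.
have [z vz Ny] : exists2 z, v != z & forall t, e y t = (t == v) || (t == z).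
  by apply: two_neighbours; rewrite // e_sym Nv.
have eyz : e y z by rewrite Ny eqxx orbT.
have yz : y != z by apply: contraTneq eyz => ->; rewrite e_irr.
have zx : z != x.
  by apply: contraTneq eyz => ->; rewrite e_sym Nx.
have zv : z != v by rewrite eq_sym.
have Eyz := E y z yz; have Exv := E x v xv; have {}Exy := Exy y yx yv.
move: Eyz; rewrite eyz mulr1 (bigD1 v) //= Ny eqxx Nv zv degv.
rewrite big1 => [|w wv]; last first.
  rewrite Ny (negPf wv) /=; have [->|] := eqVneq w z; last by rewrite mul0r.
  by rewrite e_irr mul0r.
move: Exv; rewrite exv big1 => [|w _]; last first.
  by rewrite Nx; case: eqVneq => [->|_]; rewrite ?e_irr mul0r.
(* The pair [x], [y] gives [alpha = 1/6]; then [x], [v] gives [s = -1/2] while [y], [z] gives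
   [s = -1/3]. *)
move: Exy; rewrite (degy z) // degy2 degx degv n3 /=; lra.
Qed.

(** * Complete graphs and the forward implication *)

(** Neighbour sums are [S - v 0 y], where [S] is the total of [v]. Summing the eigenvector equation
    over [y] gives [a * (n - 1) * S = 0], so [S = 0] and the equation becomes scalar. This rules out
    the triangle. *)
Lemma complete_graph_eigenvalue (R : realType) (n : nat) (e : rel 'I_n) (a : R) :
  (1 < n)%N -> (forall x y, e x y = (x != y)) -> a != 0 ->
  eigenvalue (norm_laplacian R e) a -> a = n%:R / n.-1%:R.
Proof.
move=> n_gt1 eE a0 /eigenvalueP[v vL v0].
have degE x : deg e x = n.-1.
  rewrite -[n in RHS]card_ord -(cardsC1 x); apply: eq_card => y.
  by rewrite !inE eE eq_sym.
have d0 : n.-1%:R != 0 :> R by rewrite pnatr_eq0; lia.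
have e_irr : irreflexive e by move=> x; rewrite eE eqxx.
have degP x : (0 < deg e x)%N by rewrite degE; lia.
set S := \sum_x v 0 x.
have vE y : a * n.-1%:R * v 0 y = n%:R * v 0 y - S.
  have := mul_norm_laplacian e_irr degP v y; rewrite vL mxE.
  under eq_bigr do rewrite eE degE.
  rewrite degE; set q := Num.sqrt _ => E.
  have q0 : q != 0 by rewrite gt_eqF // sqrtr_gt0 ltr0n; lia.
  have qq : q * q = n.-1%:R by rewrite -expr2 sqr_sqrtr ?ler0n.
  have nE : n%:R = n.-1%:R + 1 :> R by rewrite natr1; congr _%:R; lia.
  have SE : S = v 0 y + \sum_x (x != y)%:R * v 0 x.
    rewrite /S (bigD1 y) //= [in RHS](bigD1 y) //= eqxx mul0r add0r.
    by congr (_ + _); apply: eq_bigr => x ->; rewrite mul1r.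
  rewrite SE nE -qq.
  transitivity (a * v 0 y * q * q); first by ring.
  rewrite E mulrBl mulr_suml (eq_bigr (fun x => (x != y)%:R * v 0 x)) => [|x _].
    by ring.
  by field.
have S0 : S = 0.
  have : \sum_y a * n.-1%:R * v 0 y = 0.
    under eq_bigr do rewrite vE.
    by rewrite sumrB -mulr_sumr sumr_const card_ord mulr_natl subrr.
  rewrite -mulr_sumr -/S => /eqP.
  by rewrite !mulf_eq0 (negPf a0) (negPf d0) => /eqP.
have /rV0Pn [y vy] := v0.
apply: (mulIf d0); rewrite divfK //.
by apply: (mulIf vy); rewrite vE S0 subr0.
Qed.

Lemma unicyclic_three_eigenvalues (R : realType) (n : nat) (e : rel 'I_n) :
  unicyclic e -> num_distinct_eigenvalues_eq (norm_laplacian R e) 3 ->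
  graph_iso e (cycle_rel 4) \/ graph_iso e (cycle_rel 5).
Proof.
move=> [e_simple econ en] e3; have [e_sym e_irr] := e_simple.
have [n_gt0 _] := econ.
have esum : (\sum_x deg e x)%N = n.*2 by rewrite sum_deg // en.
(* All degrees are at most [n - 1], so [2n <= n(n - 1)] with [n] positive. *)
have n_gt2 : (2 < n)%N.
  have : (\sum_x deg e x <= \sum_(x < n) n.-1)%N.
    by apply: leq_sum => x _; have := deg_lt x e_irr; lia.
  by rewrite esum sum_nat_const card_ord; nia.
have n_gt1 : (1 < n)%N by lia.
have degP x : (0 < deg e x)%N by exact: deg_gt0.
have [alpha [s [alpha0 E]]] :=
  three_eigenvalues_common_neighbours e_simple econ n_gt1 e3.
have common x y : x != y -> ~~ e x y -> exists2 z, e x z & e z y.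
  move=> xy nexy; have := E x y xy; rewrite (negPf nexy) mulr0 subr0 => Exy.
  have [/existsP[z /andP[]]|/existsPn none] := boolP [exists z, e x z && e z y].
    by exists z.
  move: Exy; rewrite big1 => [/esym/eqP|z _]; last first.
    by rewrite (negPf (none z)) mul0r.
  by rewrite !mulf_eq0 (negPf alpha0) !pnatr_eq0 !eqn0Ngt !degP.
have deg_ge2 x : (1 < deg e x)%N.
  have := no_leaf e_simple esum n_gt2 degP alpha0 E common x.
  by have := degP x; lia.
(* Degrees at least 2 with sum [2n]: the equality case of the summed inequality holds termwise. *)
have deg2 x : deg e x = 2%N.
  have := @leqif_sum _ predT (fun x => 2 == deg e x) (fun=> 2%N) (deg e) => H.
  have {H} [|_] := H; first move=> y _.
    by apply/leqifP; case: ifP => [//|/eqP]; have := deg_ge2 y; lia.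
  rewrite sum_nat_const card_ord esum -mul2n mulnC eqxx => /esym/forallP/(_ x) /=.
  by move/eqP.
have [n3||] := two_regular_diameter2 e_simple n_gt0 deg2 common; [|by left|by right].
have eE x y : e x y = (x != y).
  have : [set y | e x y] = [set~ x].
    apply/eqP; rewrite eqEcard cardsC1 card_ord [#|[set y | e x y]|]deg2.
    apply/andP; split; last by lia.
    apply/subsetP=> z; rewrite !inE.
    by apply: contraTneq => ->; rewrite e_irr.
  by move/setP/(_ y); rewrite !inE eq_sym.
have L0 : eigenvalue (norm_laplacian R e) 0.
  apply/eigenvalueP; exists (\row_x Num.sqrt (deg e x)%:R).
    by rewrite scale0r; apply: norm_laplacian_sqrt_deg.
  apply/rV0Pn; exists (Ordinal n_gt0); rewrite !mxE.
  by rewrite gt_eqF // sqrtr_gt0 ltr0n.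
(* On the triangle both nonzero eigenvalues would equal 3/2. *)
have [a [b [[a0 b0 ab aP bP] _]]] := three_eigenvalues_nonzero e3 L0.
move: ab; rewrite (complete_graph_eigenvalue n_gt1 eE a0 aP).
by rewrite (complete_graph_eigenvalue n_gt1 eE b0 bP) eqxx.
Qed.

(** * Invariance of the spectrum under isomorphism *)

Lemma graph_iso_sym (n m : nat) (e : rel 'I_n) (e' : rel 'I_m) :
  graph_iso e e' -> graph_iso e' e.
Proof.
move=> [f [[g fK gK] fe]]; exists g; split=> [|x y]; first by exists f.
by rewrite -fe !gK.
Qed.

Lemma graph_iso_eigenvalue (R : realType) (n m : nat) (e : rel 'I_n)
    (e' : rel 'I_m) (a : R) :
  graph_iso e e' -> eigenvalue (norm_laplacian R e) a ->
  eigenvalue (norm_laplacian R e') a.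
Proof.
move=> [f [[g fK gK] fe]] /eigenvalueP[v vL /rV0Pn[x0 vx0]].
have f_inj := can_inj fK.
have degf x : deg e' (f x) = deg e x.
  rewrite /deg -(card_imset _ f_inj); apply: eq_card => y.
  by rewrite -{2}(gK y) mem_imset // !inE -fe gK.
have Lf x y : norm_laplacian R e' (f x) (f y) = norm_laplacian R e x y.
  by rewrite !norm_laplacianE fe !degf (inj_eq f_inj).
apply/eigenvalueP; exists (\row_j v 0 (g j)); last first.
  by apply/rV0Pn; exists (f x0); rewrite mxE fK.
apply/rowP=> j; move/rowP/(_ (g j)): vL; rewrite !mxE => <-.
rewrite (reindex f) /=; last by exists g => y _.
by apply: eq_bigr => x _; rewrite mxE fK -Lf gK.
Qed.

Lemma graph_iso_num_eigenvalues (R : realType) (n m k : nat) (e : rel 'I_n)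
    (e' : rel 'I_m) :
  graph_iso e e' -> num_distinct_eigenvalues_eq (norm_laplacian R e') k ->
  num_distinct_eigenvalues_eq (norm_laplacian R e) k.
Proof.
move=> ee' [s [s_uniq s_size sP]]; exists s; split=> // a; rewrite -sP.
by apply/idP/idP; apply: graph_iso_eigenvalue => //; apply: graph_iso_sym.
Qed.

(** * Spectra of the 4-cycle and the 5-cycle *)

(** On a [d]-regular graph the normalized Laplacian is the identity minus the adjacency matrix
    divided by [d], so [a] corresponds to the adjacency eigenvalue [d * (1 - a)]. The eigenvector is
    a function on [nat], so that it can be evaluated at numerals and given as an explicit list. *)
Lemma regular_eigenvalueP (R : realType) (n d : nat) (e : rel 'I_n.+1) (a : R) :
  irreflexive e -> (0 < d)%N -> (forall x, deg e x = d) ->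
  reflect (exists2 h : nat -> R, exists2 i, (i < n.+1)%N & h i != 0 &
     forall y, \sum_x (e x y)%:R * h x = d%:R * (1 - a) * h y)
    (eigenvalue (norm_laplacian R e) a).
Proof.
move=> e_irr d_gt0 degE; have degP x : (0 < deg e x)%N by rewrite degE.
pose q : R := Num.sqrt d%:R.
have q0 : q != 0 by rewrite gt_eqF // sqrtr_gt0 ltr0n.
have qq : q * q = d%:R by rewrite -expr2 sqr_sqrtr ?ler0n.
have LE (v : 'rV_n.+1) y : (v *m norm_laplacian R e) 0 y * d%:R
    = v 0 y * d%:R - \sum_x (e x y)%:R * v 0 x.
  have := mul_norm_laplacian e_irr degP v y.
  rewrite degE -/q -qq mulrA => ->; rewrite mulrBl mulrA mulr_suml.
  by congr (_ - _); apply: eq_bigr => x _; rewrite degE -/q; field.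
have d0 : d%:R != 0 :> R by rewrite pnatr_eq0; lia.
apply: (iffP eigenvalueP) => [[v vL /rV0Pn[x vx]]|[h [i i_lt hi] hE]].
  exists (fun i => v 0 (inord i)); first by exists x; rewrite ?inord_val.
  move=> y; under eq_bigr do rewrite inord_val.
  by have := LE v y; rewrite vL mxE inord_val; lra.
exists (\row_x h x); last first.
  by apply/rV0Pn; exists (Ordinal i_lt); rewrite mxE.
apply/rowP=> y; apply: (mulIf d0); rewrite LE !mxE.
by under eq_bigr do rewrite mxE; rewrite hE; ring.
Qed.

Lemma cycle4_eigenvalue (R : realType) (a : R) :
  eigenvalue (norm_laplacian R (cycle_rel 4)) a = (a * (a - 1) * (a - 2) == 0).
Proof.
have e_irr : irreflexive (cycle_rel 4) by case=> [[|[|[|[|?]]]] ?].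
have degE x : deg (cycle_rel 4) x = 2%N.
  rewrite /deg -sum1dep_card big_mkcond !big_ord_recl big_ord0.
  by case: x => [[|[|[|[|//]]]] ?].
(* With [t = 2 * (1 - a)], eliminating the other entries leaves a polynomial in [t] times one entry;
   this polynomial is [-8 * a * (a - 1) * (a - 2)]. *)
have recur (t h0 h1 h2 h3 : R) : h3 + h1 = t * h0 -> h0 + h2 = t * h1 ->
    h1 + h3 = t * h2 -> h2 + h0 = t * h3 -> t * (t ^+ 2 - 4) * h0 = 0.
  move=> H0 H1 H2 H3.
  have E0 : t * (t * (h3 + h1)) = t * (t * (t * h0)) by rewrite H0.
  have E1 : t * (h0 + h2) = t * (t * h1) by rewrite H1.
  have E3 : t * (h2 + h0) = t * (t * h3) by rewrite H3.
  by lra.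
apply/(regular_eigenvalueP a e_irr (ltn0Sn 1) degE)/eqP.
  case=> h [i i_lt hi] hE.
  have := hE (@Ordinal 4 0 isT); have := hE (@Ordinal 4 1 isT).
  have := hE (@Ordinal 4 2 isT); have := hE (@Ordinal 4 3 isT).
  rewrite !big_ord_recl !big_ord0 /cycle_rel /bump /= !mul1r !mul0r !addr0 !add0r.
  move=> H3 H2 H1 H0.
  have : 2 * (1 - a) * ((2 * (1 - a)) ^+ 2 - 4) * h i = 0.
    (* The relations are rotated so that the entry known to be nonzero comes first. *)
    case: i i_lt {hi} => [|[|[|[|//]]]] _.
    - by apply: (recur _ _ (h 1%N) (h 2%N) (h 3%N)); lra.
    - by apply: (recur _ _ (h 2%N) (h 3%N) (h 0%N)); lra.
    - by apply: (recur _ _ (h 3%N) (h 0%N) (h 1%N)); lra.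
    - by apply: (recur _ _ (h 0%N) (h 1%N) (h 2%N)); lra.
  move/eqP; rewrite mulf_eq0 (negPf hi) orbF => /eqP; lra.
pose t := 2 * (1 - a) => aP.
(* The witness is normalized to 1 at vertex 0 and symmetric under the reflection fixing it; the
   recurrence then determines the other entries. *)
exists (nth 0 [:: 1; t / 2; t ^+ 2 / 2 - 1; t / 2]).
  by exists 0%N; rewrite ?oner_eq0.
rewrite -/t => y; rewrite !big_ord_recl !big_ord0 /cycle_rel /bump /=.
have tP : t * (t ^+ 2 - 4) = 0 by rewrite /t; lra.
by case: y => [[|[|[|[|//]]]] ?] /=; rewrite !mul1r !mul0r !addr0 !add0r; lra.
Qed.

Lemma cycle5_eigenvalue (R : realType) (a : R) :
  eigenvalue (norm_laplacian R (cycle_rel 5)) a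
    = (a * (4 * a ^+ 2 - 10 * a + 5) == 0).
Proof.
have e_irr : irreflexive (cycle_rel 5) by case=> [[|[|[|[|[|?]]]]] ?].
have degE x : deg (cycle_rel 5) x = 2%N.
  rewrite /deg -sum1dep_card big_mkcond !big_ord_recl big_ord0.
  by case: x => [[|[|[|[|[|//]]]]] ?].
(* The quadratic [t ^+ 2 + t - 1] becomes [4 * a ^+ 2 - 10 * a + 5] at [t = 2 * (1 - a)], and
   [t - 2] becomes [-2 * a]. *)
have recur (t h0 h1 h2 h3 h4 : R) : h4 + h1 = t * h0 -> h0 + h2 = t * h1 ->
    h1 + h3 = t * h2 -> h2 + h4 = t * h3 -> h3 + h0 = t * h4 ->
    (t - 2) * (t ^+ 2 + t - 1) * h0 = 0.
  move=> H0 H1 H2 H3 H4.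
  have E1 : t * (h4 + h1) = t * (t * h0) by rewrite H0.
  have E2 : t * (t * (h4 + h1)) = t * (t * (t * h0)) by rewrite H0.
  have E3 : t * (h0 + h2) = t * (t * h1) by rewrite H1.
  have E4 : t * (h3 + h0) = t * (t * h4) by rewrite H4.
  by lra.
apply/(regular_eigenvalueP a e_irr (ltn0Sn 1) degE)/eqP.
  case=> h [i i_lt hi] hE.
  have := hE (@Ordinal 5 0 isT); have := hE (@Ordinal 5 1 isT).
  have := hE (@Ordinal 5 2 isT); have := hE (@Ordinal 5 3 isT).
  have := hE (@Ordinal 5 4 isT).
  rewrite !big_ord_recl !big_ord0 /cycle_rel /bump /= !mul1r !mul0r !addr0 !add0r.
  move=> H4 H3 H2 H1 H0.
  have : (2 * (1 - a) - 2) * ((2 * (1 - a)) ^+ 2 + 2 * (1 - a) - 1) * h i = 0.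
    case: i i_lt {hi} => [|[|[|[|[|//]]]]] _.
    - by apply: (recur _ _ (h 1%N) (h 2%N) (h 3%N) (h 4%N)); lra.
    - by apply: (recur _ _ (h 2%N) (h 3%N) (h 4%N) (h 0%N)); lra.
    - by apply: (recur _ _ (h 3%N) (h 4%N) (h 0%N) (h 1%N)); lra.
    - by apply: (recur _ _ (h 4%N) (h 0%N) (h 1%N) (h 2%N)); lra.
    - by apply: (recur _ _ (h 0%N) (h 1%N) (h 2%N) (h 3%N)); lra.
  move/eqP; rewrite mulf_eq0 (negPf hi) orbF => /eqP; lra.
pose t := 2 * (1 - a) => aP.
exists (nth 0 [:: 1; t / 2; t ^+ 2 / 2 - 1; t ^+ 2 / 2 - 1; t / 2]).
  by exists 0%N; rewrite ?oner_eq0.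
rewrite -/t => y; rewrite !big_ord_recl !big_ord0 /cycle_rel /bump /=.
have tP : (t - 2) * (t ^+ 2 + t - 1) = 0 by rewrite /t; lra.
by case: y => [[|[|[|[|[|//]]]]] ?] /=; rewrite !mul1r !mul0r !addr0 !add0r; lra.
Qed.

Lemma cycle4_num_eigenvalues (R : realType) :
  num_distinct_eigenvalues_eq (norm_laplacian R (cycle_rel 4)) 3.
Proof.
exists [:: 0; 1; 2]; split=> [||a]; last 1 first.
- by rewrite cycle4_eigenvalue !inE !mulf_eq0 !subr_eq0 orbA.
- rewrite /= !inE !negb_or; apply/and3P; split; last by [].
    by apply/andP; split; apply/eqP; lra.
  by apply/eqP; lra.
by [].
Qed.

Lemma cycle5_num_eigenvalues (R : realType) :
  num_distinct_eigenvalues_eq (norm_laplacian R (cycle_rel 5)) 3.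
Proof.
pose r : R := Num.sqrt 5.
have r_gt0 : 0 < r by rewrite sqrtr_gt0 ltr0n.
have rr : r * r = 5 by rewrite -expr2 sqr_sqrtr ?ler0n.
(* The last two are the roots of [4 * a ^+ 2 - 10 * a + 5], nonzero because [r * r = 5] excludes
   [r = 5] and [r = -5]. *)
exists [:: 0; (5 - r) / 4; (5 + r) / 4]; split=> [||a]; last 1 first.
- rewrite cycle5_eigenvalue !inE.
  rewrite (_ : _ * _ = a * (4 * ((a - (5 - r) / 4) * (a - (5 + r) / 4)))).
    by rewrite !mulf_eq0 !subr_eq0 pnatr_eq0.
  congr (a * _); rewrite !expr2; lra.
- rewrite /= !inE !negb_or; apply/and3P; split; last by [].
    by apply/andP; split; apply/eqP => H; nra.
  by apply/eqP; lra.
by [].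
Qed.

Theorem theorem4p1 (R : realType) (n : nat) (e : rel 'I_n) :
  unicyclic e ->
  (num_distinct_eigenvalues_eq (norm_laplacian R e) 3 <->
   graph_iso e (cycle_rel 4) \/ graph_iso e (cycle_rel 5)).
Proof.
move=> e_uni; split; first exact: unicyclic_three_eigenvalues.
case=> /graph_iso_num_eigenvalues; apply.
  exact: cycle4_num_eigenvalues.
exact: cycle5_num_eigenvalues.
Qed.
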